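(* Let $L$ be a Schrödinger-Virasoro Lie $H$-pseudoalgebra (with data $\alpha_m',\eta,\eta_{ij},\beta_i$) such that $\eta_{ij}=0$ for all $1\le i,j\le2$. Then $L$ must be one of the following algebras. (Z1) $\alpha_m'=0$, $\eta=a\otimes1$, $\beta_i=\lambda_is\otimes1-1\otimes s+\kappa_i\otimes1$ for $1\le i\le3$, where $a,\lambda_1,\lambda_2,\lambda_3,\kappa_1,\kappa_2,\kappa_3\in\mathbf{k}$ satisfy $a\lambda_1=a\kappa_1=0$. (Z2) $\alpha_m'=w_{01}(1\otimes s-s\otimes1)\ne0$, $\eta=a\otimes1$, $\beta_1=\lambda_1s\otimes1-1\otimes s+\kappa_1\otimes1$, $\beta_2=(2\lambda_1-1)s\otimes1-1\otimes s+2\kappa_1\otimes1$, $\beta_3=\lambda_3s\otimes1-1\otimes s+\kappa_3\otimes1$, where $w_{01},a,\lambda_1,\lambda_3,\kappa_1,\kappa_3\in\mathbf{k}$ satisfy $a\lambda_1=a\kappa_1=0$. (Z3) $\alpha_m'=-w_{12}\big(\kappa_1(1\otimes s^{(2)}-s^{(2)}\otimes1)-(s\otimes s^{(2)}-s^{(2)}\otimes s)-\frac{\kappa_1^2}2(1\otimes s-s\otimes1)\big)\ne0$, $\eta=0$, $\beta_1=-1\otimes s+\kappa_1\otimes1$, $\beta_2=-3s\otimes1-1\otimes s+2\kappa_1\otimes1$, $\beta_3=\lambda_3s\otimes1-1\otimes s+\kappa_3\otimes1$, where $w_{12},\lambda_3,\kappa_1,\kappa_3\in\mathbf{k}$. (Z4)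 $\alpha_m'=w_{02}\big((1\otimes s^{(2)}-s^{(2)}\otimes1)-\kappa_1(1\otimes s-s\otimes1)\big)\ne0$, $\eta=0$, $\beta_1=\frac12s\otimes1-1\otimes s+\kappa_1\otimes1$, $\beta_2=-s\otimes1-1\otimes s+2\kappa_1\otimes1$, $\beta_3=\lambda_3s\otimes1-1\otimes s+\kappa_3\otimes1$, where $w_{02},\lambda_3,\kappa_1,\kappa_3\in\mathbf{k}$. (Z5) $\alpha_m'=w_{03}\big((1\otimes s^{(3)}-s^{(3)}\otimes1)+\frac12(s\otimes s^{(2)}-s^{(2)}\otimes s)-\frac{3\kappa_1}2(1\otimes s^{(2)}-s^{(2)}\otimes1)+\frac34\kappa_1^2(1\otimes s-s\otimes1)\big)\ne0$, $\eta=0$, $\beta_1=\frac23s\otimes1-1\otimes s+\kappa_1\otimes1$, $\beta_2=-\frac53s\otimes1-1\otimes s+2\kappa_1\otimes1$, $\beta_3=\frac23s\otimes1-1\otimes s+\kappa_3\otimes1$, where $w_{03},\kappa_1,\kappa_3\in\mathbf{k}$.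
   Context: $\mathbf{k}$ is a field of characteristic zero, $\otimes=\otimes_{\mathbf{k}}$, and $H=\mathbf{k}[s]$ is the Hopf algebra with $\Delta(s)=s\otimes1+1\otimes s$; $s^{(n)}=s^n/n!$. $H^{\otimes n}$ is a right $H$-module via the iterated coproduct. $(12)$ interchanges the first two tensor factors. An $H$-pseudoalgebra is a left $H$-module $A$ with a map $[\cdot,\cdot]:A\otimes A\to H^{\otimes2}\otimes_HA$ such that $[h_1a,h_2b]=(h_1\otimes h_2\otimes_H1)[a,b]$. It is extended as follows: if $[a,b]=\sum_if_i\otimes_Hc_i$ and $[c_i,d]=\sum_jg_{ij}\otimes_Hd_{ij}$, then $[[a,b],d]=\sum(f_i\otimes1)(\Delta\otimes\mathrm{id})(g_{ij})\otimes_Hd_{ij}$; if $[d,c_i]=\sum_jg'_{ij}\otimes_Hd'_{ij}$, then $[d,[a,b]]=\sum(1\otimes f_i)(\mathrm{id}\otimes\Delta)(g'_{ij})\otimes_Hd'_{ij}$. It is a Lie $H$-pseudoalgebra if $[[a,b],c]=[a,[b,c]]-((12)\otimes_H1)[b,[a,c]]$ and $[a,b]=-((12)\otimes_H1)[b,a]$ for all $a,b,c$. A Schrödinger-Virasoro Lie $H$-pseudoalgebra is a free $H$-module $L$ with basis $\{e_0,e_1,e_2,e_3\}$ which is a Lie $H$-pseudoalgebra with pseudobrackets (others by skew-symmetry) $[e_0,e_0]=\alpha\otimes_He_0$, $[e_0,e_i]=\beta_i\otimes_He_i$ $(1\le i\le3)$, $[e_1,e_1]=\alpha_m'\otimes_He_2$,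 $[e_1,e_2]=\eta\otimes_He_2$, $[e_1,e_3]=\eta_{11}\otimes_He_1+\eta_{12}\otimes_He_2$, $[e_2,e_3]=\eta_{21}\otimes_He_1+\eta_{22}\otimes_He_2$, $[e_2,e_2]=[e_3,e_3]=0$, where $\alpha=s\otimes1-1\otimes s$, $\beta_i=\lambda_is\otimes1-1\otimes s+\kappa_i\otimes1$ with $\lambda_i,\kappa_i\in\mathbf{k}$, $\alpha_m',\eta,\eta_{ij}\in H^{\otimes2}$, $\alpha_0'=0$, and for $m\ge1$ $\alpha_m'=\sum_{0\le i,j\le m}c_{ij}s^{(i)}\otimes s^{(j)}$ with $c_{im},c_{mj}$ not all zero.
   Formalization: In (Z5) the coefficient 2/3 of s⊗1 in β_3 is replaced by an arbitrary λ_3 in k, since with η_ij=0 the algebra of (Z5) is a Lie H-pseudoalgebra for every λ_3 (for example λ_3=0), so the printed list is incomplete. *)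

(* Defs.v *)
From HB Require Import structures.
From mathcomp Require Import all_boot all_order all_fingroup all_algebra.
From mathcomp Require Import generic_quotient boolp.
From mathcomp Require Import mpoly.

Set Implicit Arguments.
Unset Strict Implicit.
Unset Printing Implicit Defensive.

Import GRing.Theory.
Local Open Scope ring_scope.
Local Open Scope quotient_scope.

Reserved Notation "h \ox g" (at level 40, left associativity).
Reserved Notation "f \oxH a" (at level 40, left associativity).

(* H = k[s] is {poly k} with s = 'X, and H^{(x) n} is identified with the
   polynomial ring k[s_0, .., s_(n-1)] = {mpoly k[n]}: the pure tensor
   h_0 (x) .. (x) h_(n-1) is the polynomial h_0(s_0) * .. * h_(n-1)(s_(n-1)). *)
Section HopfAlgebra.
Variable k : fieldType.

Definition tensor2 (h g : {poly k}) : {mpoly k[2]} :=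
  horner_alg ('X_(0 : 'I_2) : {mpoly k[2]}) h *
  horner_alg ('X_(1 : 'I_2) : {mpoly k[2]}) g.

(* The iterated coproduct H -> H^{(x) n}, n >= 1: the algebra morphism sending
   s to the sum of the 1 (x) .. (x) s (x) .. (x) 1. *)
Definition coprod (n : nat) (h : {poly k}) : {mpoly k[n]} :=
  horner_alg (\sum_(i < n) 'X_i : {mpoly k[n]}) h.

(* f (x) 1, 1 (x) f, (Delta (x) id) f, (id (x) Delta) f *)
Definition tensor_one (f : {mpoly k[2]}) : {mpoly k[3]} :=
  f \mPo [tuple 'X_(inord 0); 'X_(inord 1)].
Definition one_tensor (f : {mpoly k[2]}) : {mpoly k[3]} :=
  f \mPo [tuple 'X_(inord 1); 'X_(inord 2)].
Definition Delta_id (f : {mpoly k[2]}) : {mpoly k[3]} :=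
  f \mPo [tuple 'X_(inord 0) + 'X_(inord 1); 'X_(inord 2)].
Definition id_Delta (f : {mpoly k[2]}) : {mpoly k[3]} :=
  f \mPo [tuple 'X_(inord 0); 'X_(inord 1) + 'X_(inord 2)].

Definition swap12 (n : nat) (f : {mpoly k[n.+2]}) : {mpoly k[n.+2]} :=
  msym (tperm 0 1) f.

Definition divpow (n : nat) : {poly k} := (n`!%:R)^-1 *: 'X^n.

End HopfAlgebra.

Notation "h \ox g" := (tensor2 h g) : ring_scope.

(* The tensor product H^{(x) n} (x)_H A, where the right H-module structure of
   H^{(x) n} is f.h = f * coprod n h: formal sums of pairs (f, a), two of which
   are identified when no H-balanced biadditive map tells them apart. *)
Section TensorProduct.
Variables (k : fieldType) (n : nat) (A : lmodType {poly k}).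

Definition balanced (V : zmodType) (phi : {mpoly k[n]} -> A -> V) : Prop :=
  [/\ forall f g a, phi (f + g) a = phi f a + phi g a,
      forall f a b, phi f (a + b) = phi f a + phi f b
    & forall f h a, phi (f * coprod n h) a = phi f (h *: a)].

Definition tensor_eq (x y : seq ({mpoly k[n]} * A)) : Prop :=
  forall (V : zmodType) (phi : {mpoly k[n]} -> A -> V), balanced phi ->
  \sum_(p <- x) phi p.1 p.2 = \sum_(p <- y) phi p.1 p.2.

Definition tensor_eqb x y : bool := `[< tensor_eq x y >].

Lemma tensor_eqb_equiv : equiv_class_of tensor_eqb.
Proof.
split=> [x|x y|y x z].
- by apply/asboolP.
- by apply/asboolP/asboolP => h V phi b; rewrite h.
- by move=> /asboolP h1 /asboolP h2; apply/asboolP => V phi b; rewrite h1 ?h2.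
Qed.

Canonical tensor_equiv := EquivRelPack tensor_eqb_equiv.

Definition tensorH := {eq_quot tensor_equiv}.
HB.instance Definition _ := Choice.on tensorH.
HB.instance Definition _ := EqQuotient.on tensorH.

Definition tpure (f : {mpoly k[n]}) (a : A) : tensorH := \pi_tensorH [:: (f, a)].

Lemma tensorP x y : reflect (tensor_eq x y) (\pi_tensorH x == \pi_tensorH y).
Proof. by rewrite eqmodE; apply: asboolP. Qed.

Lemma repr_tensor_eq x : tensor_eq (repr (\pi_tensorH x)) x.
Proof. by apply/tensorP; rewrite reprK. Qed.

Definition tadd (x y : tensorH) : tensorH := \pi_tensorH (repr x ++ repr y).
Definition topp (x : tensorH) : tensorH :=
  \pi_tensorH [seq (- p.1, p.2) | p <- repr x].

Lemma balancedN (V : zmodType) (phi : {mpoly k[n]} -> A -> V) f a :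
  balanced phi -> phi (- f) a = - phi f a.
Proof.
case=> hl _ _; apply/eqP; rewrite -addr_eq0 -hl addNr.
by rewrite -(inj_eq (addrI (phi 0 a))) -hl !addr0.
Qed.

Lemma taddE x y : tadd (\pi_tensorH x) (\pi_tensorH y) = \pi_tensorH (x ++ y).
Proof.
apply/eqP/tensorP => V phi b; rewrite !big_cat /=.
by rewrite !(repr_tensor_eq _ b).
Qed.

Lemma toppE x : topp (\pi_tensorH x) = \pi_tensorH [seq (- p.1, p.2) | p <- x].
Proof.
apply/eqP/tensorP => V phi b; rewrite !big_map /=.
have sN s : \sum_(p <- s) phi (- p.1) p.2 = - \sum_(p <- s) phi p.1 p.2.
  by rewrite -sumrN; apply: eq_bigr => p _; apply: balancedN.
by rewrite !sN (repr_tensor_eq _ b).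
Qed.

Lemma taddA : associative tadd.
Proof.
by elim/(@quotW _ tensorH)=> x; elim/(@quotW _ tensorH)=> y; elim/(@quotW _ tensorH)=> z; rewrite !taddE catA.
Qed.

Lemma taddC : commutative tadd.
Proof.
elim/(@quotW _ tensorH)=> x; elim/(@quotW _ tensorH)=> y; rewrite !taddE.
by apply/eqP/tensorP => V phi b; rewrite !big_cat /= addrC.
Qed.

Lemma tadd0 : left_id (\pi_tensorH [::]) tadd.
Proof. by elim/(@quotW _ tensorH)=> x; rewrite taddE. Qed.

Lemma taddN : left_inverse (\pi_tensorH [::]) topp tadd.
Proof.
elim/(@quotW _ tensorH)=> x; rewrite toppE taddE.
apply/eqP/tensorP => V phi b; rewrite big_cat big_map big_nil /= -big_split /=.
by rewrite big1 // => p _; rewrite balancedN // addNr.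
Qed.

HB.instance Definition _ :=
  GRing.isZmodule.Build tensorH taddA taddC tadd0 taddN.

Lemma tpure_balanced : balanced tpure.
Proof.
split=> [f g a|f a b|f h a]; rewrite /tpure.
- rewrite [RHS]taddE; apply/eqP/tensorP => V phi [hl hr hb].
  by rewrite big_cat !big_seq1 /= hl.
- rewrite [RHS]taddE; apply/eqP/tensorP => V phi [hl hr hb].
  by rewrite big_cat !big_seq1 /= hr.
- by apply/eqP/tensorP => V phi [hl hr hb]; rewrite !big_seq1 /= hb.
Qed.

(* The map induced on the tensor product by phi; it does not depend on the
   chosen representative when phi is balanced (tlift_pure, tliftD). *)
Definition tlift (V : zmodType) (phi : {mpoly k[n]} -> A -> V) (x : tensorH)
  : V := \sum_(p <- repr x) phi p.1 p.2.

Lemma tlift_pure (V : zmodType) (phi : {mpoly k[n]} -> A -> V) f a :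
  balanced phi -> tlift phi (tpure f a) = phi f a.
Proof. by move=> b; rewrite /tlift (repr_tensor_eq _ b) big_seq1. Qed.

Lemma tliftD (V : zmodType) (phi : {mpoly k[n]} -> A -> V) x y :
  balanced phi -> tlift phi (x + y) = tlift phi x + tlift phi y.
Proof. by move=> b; rewrite /tlift (repr_tensor_eq _ b) big_cat. Qed.

Lemma tensor_sum (x : tensorH) : x = \sum_(p <- repr x) tpure p.1 p.2.
Proof.
rewrite -{1}[x]reprK; elim: (repr x) => [|[f a] s IHs]; first by rewrite big_nil.
by rewrite big_cons -IHs -cat1s -taddE.
Qed.

End TensorProduct.

Notation "f \oxH a" := (tpure f a) : ring_scope.

Section PseudoAlgebra.
Variables (k : fieldType) (A : lmodType {poly k}).

Definition tmul (n : nat) (F : {mpoly k[n]}) (x : tensorH n A) : tensorH n A :=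
  tlift (fun f a => (F * f) \oxH a) x.

Definition tswap12 (n : nat) (x : tensorH n.+2 A) : tensorH n.+2 A :=
  tlift (fun f a => swap12 f \oxH a) x.

Variable br : A -> A -> tensorH 2 A.

Definition br_left (x : tensorH 2 A) (d : A) : tensorH 3 A :=
  tlift (fun f c =>
    tlift (fun g u => (tensor_one f * Delta_id g) \oxH u) (br c d)) x.

Definition br_right (d : A) (x : tensorH 2 A) : tensorH 3 A :=
  tlift (fun f c =>
    tlift (fun g u => (one_tensor f * id_Delta g) \oxH u) (br d c)) x.

Definition is_pseudoalgebra : Prop :=
  [/\ forall a b c, br (a + b) c = br a c + br b c,
      forall a b c, br a (b + c) = br a b + br a c
    & forall h1 h2 a b, br (h1 *: a) (h2 *: b) = tmul (h1 \ox h2) (br a b)].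

Definition is_lie_pseudoalgebra : Prop :=
  [/\ is_pseudoalgebra,
      forall a b c, br_left (br a b) c =
        br_right a (br b c) - tswap12 (br_right b (br a c))
    & forall a b, br a b = - tswap12 (br b a)].

Definition is_basis (n : nat) (e : n.-tuple A) : Prop :=
  forall x : A, exists! c : {ffun 'I_n -> {poly k}},
    x = \sum_i c i *: tnth e i.

End PseudoAlgebra.

Section SchrodingerVirasoro.
Variable k : fieldType.

Definition is_alpha' (m : nat) (x : {mpoly k[2]}) : Prop :=
  if m == 0%N then x = 0 else
  exists c : nat -> nat -> k,
    x = \sum_(i < m.+1) \sum_(j < m.+1) c i j *: (divpow k i \ox divpow k j)
    /\ exists2 i, (i <= m)%N & c i m != 0 \/ c m i != 0.

Definition alpha : {mpoly k[2]} := 'X \ox 1 - 1 \ox 'X.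

Definition beta_form (lambda kappa : k) : {mpoly k[2]} :=
  (lambda *: 'X) \ox 1 - 1 \ox 'X + kappa%:P \ox 1.

Record sv_data (L : lmodType {poly k}) := SVData {
  e0 : L; e1 : L; e2 : L; e3 : L;
  beta1 : {mpoly k[2]}; beta2 : {mpoly k[2]}; beta3 : {mpoly k[2]};
  alpha' : {mpoly k[2]};
  eta : {mpoly k[2]};
  eta11 : {mpoly k[2]}; eta12 : {mpoly k[2]};
  eta21 : {mpoly k[2]}; eta22 : {mpoly k[2]} }.

Record schrodinger_virasoro (L : lmodType {poly k})
    (br : L -> L -> tensorH 2 L) (D : sv_data L) : Prop := {
  sv_basis : is_basis [tuple e0 D; e1 D; e2 D; e3 D];
  sv_lie : is_lie_pseudoalgebra br;
  sv_alpha' : exists m, is_alpha' m (alpha' D);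
  sv_beta1 : exists lambda kappa, beta1 D = beta_form lambda kappa;
  sv_beta2 : exists lambda kappa, beta2 D = beta_form lambda kappa;
  sv_beta3 : exists lambda kappa, beta3 D = beta_form lambda kappa;
  sv_br00 : br (e0 D) (e0 D) = alpha \oxH e0 D;
  sv_br01 : br (e0 D) (e1 D) = beta1 D \oxH e1 D;
  sv_br02 : br (e0 D) (e2 D) = beta2 D \oxH e2 D;
  sv_br03 : br (e0 D) (e3 D) = beta3 D \oxH e3 D;
  sv_br11 : br (e1 D) (e1 D) = alpha' D \oxH e2 D;
  sv_br12 : br (e1 D) (e2 D) = eta D \oxH e2 D;
  sv_br13 : br (e1 D) (e3 D) = eta11 D \oxH e1 D + eta12 D \oxH e2 D;
  sv_br23 : br (e2 D) (e3 D) = eta21 D \oxH e1 D + eta22 D \oxH e2 D;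
  sv_br22 : br (e2 D) (e2 D) = 0;
  sv_br33 : br (e3 D) (e3 D) = 0 }.

(* s^(i) (x) s^(j) - s^(j) (x) s^(i) *)
Definition wedge (i j : nat) : {mpoly k[2]} :=
  divpow k i \ox divpow k j - divpow k j \ox divpow k i.

Variables (L : lmodType {poly k}) (D : sv_data L).

Definition Z1 : Prop :=
  exists a l1 l2 l3 k1 k2 k3 : k,
    alpha' D = 0 /\ eta D = a%:P \ox 1 /\
    beta1 D = beta_form l1 k1 /\ beta2 D = beta_form l2 k2 /\
    beta3 D = beta_form l3 k3 /\
    a * l1 = 0 /\ a * k1 = 0.

Definition Z2 : Prop :=
  exists w01 a l1 l3 k1 k3 : k,
    alpha' D = w01 *: wedge 0 1 /\ alpha' D != 0 /\ eta D = a%:P \ox 1 /\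
    beta1 D = beta_form l1 k1 /\
    beta2 D = beta_form (2 * l1 - 1) (2 * k1) /\
    beta3 D = beta_form l3 k3 /\
    a * l1 = 0 /\ a * k1 = 0.

Definition Z3 : Prop :=
  exists w12 l3 k1 k3 : k,
    alpha' D = - (w12 *: (k1 *: wedge 0 2 - wedge 1 2
                          - (k1 ^+ 2 / 2) *: wedge 0 1)) /\
    alpha' D != 0 /\ eta D = 0 /\
    beta1 D = beta_form 0 k1 /\
    beta2 D = beta_form (- 3) (2 * k1) /\
    beta3 D = beta_form l3 k3.

Definition Z4 : Prop :=
  exists w02 l3 k1 k3 : k,
    alpha' D = w02 *: (wedge 0 2 - k1 *: wedge 0 1) /\
    alpha' D != 0 /\ eta D = 0 /\
    beta1 D = beta_form (1 / 2) k1 /\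
    beta2 D = beta_form (- 1) (2 * k1) /\
    beta3 D = beta_form l3 k3.

(* The coefficient of s (x) 1 in beta_3 is an arbitrary l3, as in Z1-Z4. The
   value 2/3 that is printed for it in the literature is a misprint: with
   [e_1, e_3] = [e_2, e_3] = [e_3, e_3] = 0 the scalars l3 and k3 enter the
   Jacobi identity only through (e_0, e_0, e_3), which holds for all l3, k3. *)
Definition Z5 : Prop :=
  exists w03 l3 k1 k3 : k,
    alpha' D = w03 *: (wedge 0 3 + (1 / 2) *: wedge 1 2
                       - (3 * k1 / 2) *: wedge 0 2
                       + (3 / 4 * k1 ^+ 2) *: wedge 0 1) /\
    alpha' D != 0 /\ eta D = 0 /\
    beta1 D = beta_form (2 / 3) k1 /\
    beta2 D = beta_form (- (5 / 3)) (2 * k1) /\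
    beta3 D = beta_form l3 k3.

End SchrodingerVirasoro.

(* Main.v *)
(** Every Jacobi identity becomes a polynomial identity for alpha' or eta once
    the coordinates on the basis e_0, .., e_3 are taken. In the triple
    (e_0, e_1, x) let f be alpha' (x = e_1) or eta (x = e_2), and expand f in
    divided powers d_ij of the shifted variables s_0 - kappa and s_1 - kappa';
    the identity then splits into the recursion

      ((n+1) l - i) d_(n+i, j) + ((n+1) l' - j) d_(i, n+j) = [n = 0] m d_ij.

    Its case n = 0 says that f is homogeneous of degree N = l + l' - m. For the
    skew-symmetric alpha', comparing d_(0,N) with d_(1,N-1), d_(N-1,1),
    d_(2,N-2), d_(N-2,2) leaves only N = 1, 2, 3. For eta, the identity of
    (e_1, e_1, e_2) with s_1 = 0 shows d_(0,j) = 0 for j > 0, and the recursion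
    forces eta to be constant. The identity of (e_1, e_1, e_1) kills this
    constant in case Z3. *)

From HB Require Import structures.
Require Import Defs.
From mathcomp Require Import all_boot all_order all_algebra.
From mathcomp Require Import perm boolp fraction.
From mathcomp Require Import mpoly.
From mathcomp Require Import ring.
Import GRing.Theory.
Local Open Scope ring_scope.

Set Implicit Arguments.
Unset Strict Implicit.
Unset Printing Implicit Defensive.

(** * Evaluation of polynomials in two and three variables *)

Lemma msymXU (R : nzRingType) n (s : 'S_n) i :
  msym s ('X_i : {mpoly R[n]}) = 'X_(s i).
Proof.
rewrite msymX; congr 'X_[_]; apply/mnmP => j.
by rewrite mnmE !mnm1E -(inj_eq (@perm_inj _ s)) permKV.
Qed.

Lemma msymC (R : nzRingType) n (s : 'S_n) (c : R) :
  msym s (c%:MP : {mpoly R[n]}) = c%:MP.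
Proof. by rewrite -[c%:MP]mulr1 mul_mpolyC msymZ msym1. Qed.

Section MpolyMorphisms.
Variables (R : comNzRingType) (S : comNzRingType).
Implicit Type phi : {rmorphism R -> S}.

(** Constants and variables generate the polynomial ring, so they determine a ring morphism out of
    it. Composites of substitutions are recognised as evaluations in this way. *)
Lemma mpoly_initial n (h : {rmorphism {mpoly R[n]} -> S}) p :
  h p = mmap (h \o @mpolyC n R) (fun i => h 'X_i) p.
Proof.
rewrite [p in LHS]mpolyE rmorph_sum /=; apply: eq_bigr => m _.
rewrite -mul_mpolyC rmorphM /= mpolyXE_id rmorph_prod /=.
by congr (_ * _); apply: eq_bigr => i _; rewrite rmorphXn.
Qed.

(** Points lie in an arbitrary commutative ring over [R], because formal variables, elements of a
    fraction field and special values such as 0 all get substituted. *)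
Definition ev2 phi (y z : S) (f : {mpoly R[2]}) : S :=
  mmap phi (tnth [tuple y; z]) f.
HB.instance Definition _ phi y z :=
  GRing.isAdditive.Build _ _ (ev2 phi y z) (mmap_is_additive _ _).
HB.instance Definition _ phi y z :=
  GRing.isMultiplicative.Build _ _ (ev2 phi y z) (mmap_is_multiplicative _ _).

Definition ev3 phi (x y z : S) (f : {mpoly R[3]}) : S :=
  mmap phi (tnth [tuple x; y; z]) f.
HB.instance Definition _ phi x y z :=
  GRing.isAdditive.Build _ _ (ev3 phi x y z) (mmap_is_additive _ _).
HB.instance Definition _ phi x y z :=
  GRing.isMultiplicative.Build _ _ (ev3 phi x y z) (mmap_is_multiplicative _ _).

Lemma ev2D phi y z f g :
  ev2 phi y z (f + g) = ev2 phi y z f + ev2 phi y z g.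
Proof. exact: rmorphD. Qed.

Lemma ev2B phi y z f g :
  ev2 phi y z (f - g) = ev2 phi y z f - ev2 phi y z g.
Proof. exact: rmorphB. Qed.

Lemma ev2C phi y z c : ev2 phi y z c%:MP = phi c.
Proof. exact: mmapC. Qed.

Lemma ev2X phi y z i : ev2 phi y z 'X_i = tnth [tuple y; z] i.
Proof. by rewrite /ev2 mmapX mmap1U. Qed.

Lemma ev3C phi x y z c : ev3 phi x y z c%:MP = phi c.
Proof. exact: mmapC. Qed.

Lemma ev3X phi x y z i : ev3 phi x y z 'X_i = tnth [tuple x; y; z] i.
Proof. by rewrite /ev3 mmapX mmap1U. Qed.

Lemma ev2Z phi y z c f : ev2 phi y z (c *: f) = phi c * ev2 phi y z f.
Proof. exact: mmapZ. Qed.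

Lemma ev3_comp phi x y z (p q : {mpoly R[3]}) f :
  ev3 phi x y z (f \mPo [tuple p; q]) =
  ev2 phi (ev3 phi x y z p) (ev3 phi x y z q) f.
Proof.
rewrite -[LHS]/((ev3 phi x y z \o comp_mpoly [tuple p; q]) f) mpoly_initial.
apply: eq_bigr => m _ /=; rewrite comp_mpolyC ev3C; congr (_ * _).
apply: eq_bigr => i _; congr (_ ^+ _); rewrite comp_mpolyXU -tnth_nth.
by case: i => [[|[|i]] lt_i] //=; rewrite !(tnth_nth 0).
Qed.

End MpolyMorphisms.

Section Coproducts.
Variable k : fieldType.

Variables (S : comNzRingType) (phi : {rmorphism k -> S}) (x y z : S).

Lemma ev3_tensor_one f : ev3 phi x y z (tensor_one f) = ev2 phi x y f.
Proof. by rewrite ev3_comp !ev3X !(tnth_nth 0) /= !inordK. Qed.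

Lemma ev3_one_tensor f : ev3 phi x y z (one_tensor f) = ev2 phi y z f.
Proof. by rewrite ev3_comp !ev3X !(tnth_nth 0) /= !inordK. Qed.

Lemma ev3_Delta_id f : ev3 phi x y z (Delta_id f) = ev2 phi (x + y) z f.
Proof. by rewrite ev3_comp rmorphD /= !ev3X !(tnth_nth 0) /= !inordK. Qed.

Lemma ev3_id_Delta f : ev3 phi x y z (id_Delta f) = ev2 phi x (y + z) f.
Proof. by rewrite ev3_comp rmorphD /= !ev3X !(tnth_nth 0) /= !inordK. Qed.

Lemma ev3_swap12 f : ev3 phi x y z (swap12 f) = ev3 phi y x z f.
Proof.
rewrite -[LHS]/((ev3 phi x y z \o msym (tperm 0 1)) f) mpoly_initial.
apply: eq_bigr => m _ /=; rewrite msymC ev3C.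
congr (_ * _).
apply: eq_bigr => i _; congr (_ ^+ _); rewrite msymXU ev3X !(tnth_nth 0).
by case: i => [[|[|[|i]]] lt_i] //=; rewrite permE.
Qed.

Lemma ev2_swap12 f : ev2 phi x y (swap12 f) = ev2 phi y x f.
Proof.
rewrite -[LHS]/((ev2 phi x y \o msym (tperm 0 1)) f) mpoly_initial.
apply: eq_bigr => m _ /=; rewrite msymC ev2C.
congr (_ * _).
apply: eq_bigr => i _; congr (_ ^+ _); rewrite msymXU ev2X !(tnth_nth 0).
by case: i => [[|[|i]] lt_i] //=; rewrite permE.
Qed.
End Coproducts.

Lemma poly_rmorph_ext (R S : nzRingType) (F G : {rmorphism {poly R} -> S}) :
  (forall c, F c%:P = G c%:P) -> F 'X = G 'X -> F =1 G.
Proof.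
move=> FGC FGX; elim/poly_ind => [|p c IHp]; first by rewrite !rmorph0.
by rewrite !rmorphD !rmorphM /= FGC FGX IHp.
Qed.

(** * Compatibility of the coproduct with the maps into three tensor factors *)

Section CoproductMorphisms.
Variable k : fieldType.
Implicit Types (f : {mpoly k[2]}) (h : {poly k}).

HB.instance Definition _ n :=
  GRing.LRMorphism.copy (@coprod k n) (horner_alg (\sum_(i < n) 'X_i)).
HB.instance Definition _ :=
  GRing.LRMorphism.copy (@tensor_one k) (comp_mpoly [tuple 'X_(inord 0); 'X_(inord 1)]).
HB.instance Definition _ :=
  GRing.LRMorphism.copy (@one_tensor k) (comp_mpoly [tuple 'X_(inord 1); 'X_(inord 2)]).
HB.instance Definition _ :=
  GRing.LRMorphism.copy (@Delta_id k)
    (comp_mpoly [tuple 'X_(inord 0) + 'X_(inord 1); 'X_(inord 2)]).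
HB.instance Definition _ :=
  GRing.LRMorphism.copy (@id_Delta k)
    (comp_mpoly [tuple 'X_(inord 0); 'X_(inord 1) + 'X_(inord 2)]).
HB.instance Definition _ n :=
  GRing.LRMorphism.copy (@swap12 k n) (msym (tperm 0 1)).

Lemma coprodC n c : coprod n c%:P = c%:MP :> {mpoly k[n]}.
Proof. by rewrite /coprod horner_algC alg_mpolyC. Qed.

Lemma coprodX n : coprod n 'X = \sum_(i < n) 'X_i :> {mpoly k[n]}.
Proof. exact: horner_algX. Qed.

Lemma tensor_l h : h \ox 1 = horner_alg 'X_0 h.
Proof. by rewrite /tensor2 rmorph1 mulr1. Qed.

Lemma tensor_r h : 1 \ox h = horner_alg 'X_1 h.
Proof. by rewrite /tensor2 rmorph1 mul1r. Qed.

Lemma Delta_idX i : Delta_id ('X_i : {mpoly k[2]}) =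
  [tuple 'X_(inord 0) + 'X_(inord 1); 'X_(inord 2)]`_i.
Proof. exact: comp_mpolyXU. Qed.
Lemma id_DeltaX i : id_Delta ('X_i : {mpoly k[2]}) =
  [tuple 'X_(inord 0); 'X_(inord 1) + 'X_(inord 2)]`_i.
Proof. exact: comp_mpolyXU. Qed.
Lemma tensor_oneX i : tensor_one ('X_i : {mpoly k[2]}) =
  [tuple 'X_(inord 0); 'X_(inord 1)]`_i.
Proof. exact: comp_mpolyXU. Qed.
Lemma one_tensorX i : one_tensor ('X_i : {mpoly k[2]}) =
  [tuple 'X_(inord 1); 'X_(inord 2)]`_i.
Proof. exact: comp_mpolyXU. Qed.

Lemma sum3_inord :
  \sum_(i < 3) 'X_i = 'X_(inord 0) + 'X_(inord 1) + 'X_(inord 2) :> {mpoly k[3]}.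
Proof.
rewrite !big_ord_recr big_ord0 /= add0r.
by congr ('X_ _ + 'X_ _ + 'X_ _); apply: val_inj; rewrite /= inordK.
Qed.

(** Coassociativity: on both sides the generator ['X] goes to the sum of the three variables. *)
Lemma Delta_id_coprod h : Delta_id (coprod 2 h) = coprod 3 h.
Proof.
apply: (poly_rmorph_ext (F := @Delta_id k \o coprod 2) (G := coprod 3)) => [c|] /=.
  by rewrite !coprodC; exact: comp_mpolyC.
rewrite !coprodX sum3_inord !big_ord_recr big_ord0 /= add0r rmorphD /=.
by rewrite !Delta_idX.
Qed.

Lemma id_Delta_coprod h : id_Delta (coprod 2 h) = coprod 3 h.
Proof.
apply: (poly_rmorph_ext (F := @id_Delta k \o coprod 2) (G := coprod 3)) => [c|] /=.
  by rewrite !coprodC; exact: comp_mpolyC.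
rewrite !coprodX sum3_inord !big_ord_recr big_ord0 /= add0r rmorphD /=.
by rewrite !id_DeltaX addrA.
Qed.

(** Both sides are $\Delta(h)\otimes1$. This lets a scalar cross $\otimes_H$ inside [br_left];
    [one_tensor_coprod] does the same for [br_right]. *)
Lemma tensor_one_coprod h : tensor_one (coprod 2 h) = Delta_id (h \ox 1).
Proof.
rewrite tensor_l; apply: (poly_rmorph_ext (F := @tensor_one k \o coprod 2)
  (G := @Delta_id k \o horner_alg 'X_0)) => [c|] /=.
  rewrite coprodC horner_algC alg_mpolyC.
  by transitivity (c%:MP : {mpoly k[3]}); [|symmetry]; exact: comp_mpolyC.
rewrite coprodX !big_ord_recr big_ord0 /= add0r rmorphD /=.
by rewrite !tensor_oneX horner_algX Delta_idX.
Qed.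

Lemma one_tensor_coprod h : one_tensor (coprod 2 h) = id_Delta (1 \ox h).
Proof.
rewrite tensor_r; apply: (poly_rmorph_ext (F := @one_tensor k \o coprod 2)
  (G := @id_Delta k \o horner_alg 'X_1)) => [c|] /=.
  rewrite coprodC horner_algC alg_mpolyC.
  by transitivity (c%:MP : {mpoly k[3]}); [|symmetry]; exact: comp_mpolyC.
rewrite coprodX !big_ord_recr big_ord0 /= add0r rmorphD /=.
by rewrite !one_tensorX horner_algX id_DeltaX.
Qed.

(** Cocommutativity of $H$: permuting the variables fixes their sum. It makes [tswap12] well
    defined. *)
Lemma swap12_coprod n h : swap12 (coprod n.+2 h) = coprod n.+2 h.
Proof.
apply: (poly_rmorph_ext (F := @swap12 k n \o coprod n.+2) (G := coprod n.+2)) => [c|] /=.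
  by rewrite !coprodC; exact: msymC.
rewrite coprodX rmorph_sum (reindex_inj (@perm_inj _ (tperm 0 1))) /=.
by apply: eq_bigr => i _; rewrite /swap12 msymXU tpermK.
Qed.

End CoproductMorphisms.

(** * Tensor products over H *)

Section TensorLifts.
Variables (k : fieldType) (L : lmodType {poly k}).

Lemma tpureDl n (f g : {mpoly k[n]}) (a : L) :
  (f + g) \oxH a = f \oxH a + g \oxH a.
Proof. by case: (tpure_balanced n L) => ->. Qed.

Lemma tpureDr n (f : {mpoly k[n]}) (a b : L) :
  f \oxH (a + b) = f \oxH a + f \oxH b.
Proof. by case: (tpure_balanced n L) => _ ->. Qed.

Lemma tpureZ n (f : {mpoly k[n]}) h (a : L) :
  (f * coprod n h) \oxH a = f \oxH (h *: a).
Proof. by case: (tpure_balanced n L) => _ _ ->. Qed.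

Lemma tpureNl n (f : {mpoly k[n]}) (a : L) : (- f) \oxH a = - (f \oxH a).
Proof. exact: balancedN (tpure_balanced n L). Qed.

Lemma tpure0l n (a : L) : (0 : {mpoly k[n]}) \oxH a = 0.
Proof. by apply: (addrI (0 \oxH a)); rewrite -tpureDl !addr0. Qed.

Lemma tlift_zmod n (V : zmodType) (phi : {mpoly k[n]} -> L -> V) :
  balanced phi -> zmod_morphism (tlift phi).
Proof.
by move=> b x y; apply: (addIr (tlift phi y)); rewrite -tliftD // !subrK.
Qed.

Lemma tlift0 n (V : zmodType) (phi : {mpoly k[n]} -> L -> V) :
  balanced phi -> tlift phi 0 = 0.
Proof. by move=> /tlift_zmod/(_ 0 0); rewrite !subrr. Qed.

Lemma tlift_tlift n m (V : zmodType) (phi : {mpoly k[m]} -> L -> V)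
    (psi : {mpoly k[n]} -> L -> tensorH m L) x :
  balanced phi ->
  tlift phi (tlift psi x) = tlift (fun f a => tlift phi (psi f a)) x.
Proof.
by move=> b; apply: (big_morph (tlift phi)) => [u v|]; [exact: tliftD | exact: tlift0].
Qed.

Lemma eq_tlift n (V : zmodType) (phi psi : {mpoly k[n]} -> L -> V) x :
  (forall f a, phi f a = psi f a) -> tlift phi x = tlift psi x.
Proof. by move=> eq_phi; apply: eq_bigr => p _. Qed.

Lemma tlift_add n (V : zmodType) (phi psi : {mpoly k[n]} -> L -> V) x :
  tlift (fun f a => phi f a + psi f a) x = tlift phi x + tlift psi x.
Proof. exact: big_split. Qed.

Lemma balanced_tpure n m (F : {mpoly k[n]} -> {mpoly k[m]}) :
  (forall f g, F (f + g) = F f + F g) ->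
  (forall f h, F (f * coprod n h) = F f * coprod m h) ->
  balanced (fun f (a : L) => F f \oxH a).
Proof.
by move=> FD FZ; split=> [f g a|f a b|f h a]; rewrite ?FD ?FZ (tpureDl, tpureDr, tpureZ).
Qed.

Lemma balanced_swap12 n : balanced (fun f (a : L) => (@swap12 k n f) \oxH a).
Proof.
by apply: balanced_tpure => [f g|f h]; rewrite ?rmorphD ?rmorphM //= swap12_coprod.
Qed.

Lemma tswap12_pure n f (a : L) : tswap12 (f \oxH a) = (@swap12 k n f) \oxH a.
Proof. exact: tlift_pure (balanced_swap12 n). Qed.

Lemma balanced_left (F : {mpoly k[3]}) :
  balanced (fun g (u : L) => (F * Delta_id g) \oxH u).
Proof.
apply: (balanced_tpure (F := fun g => F * Delta_id g)) => [f g|f h].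
  by rewrite rmorphD mulrDr.
by rewrite rmorphM /= Delta_id_coprod mulrA.
Qed.

Lemma balanced_right (F : {mpoly k[3]}) :
  balanced (fun g (u : L) => (F * id_Delta g) \oxH u).
Proof.
apply: (balanced_tpure (F := fun g => F * id_Delta g)) => [f g|f h].
  by rewrite rmorphD mulrDr.
by rewrite rmorphM /= id_Delta_coprod mulrA.
Qed.

Variable br : L -> L -> tensorH 2 L.
Hypothesis br_pseudo : is_pseudoalgebra br.

Lemma balanced_br_left d : balanced (fun f c =>
  tlift (fun g u => (tensor_one f * Delta_id g) \oxH u) (br c d)).
Proof.
have [brDl brDr brZ] := br_pseudo; split=> [f g c|f a b|f h c].
- rewrite -tlift_add; apply: eq_tlift => F a.
  by rewrite rmorphD mulrDl tpureDl.
- by rewrite brDl tliftD //; exact: balanced_left.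
(* With [d] written as [1 *: d], sesquilinearity pulls [h] out of the bracket as [h \ox 1], and
   [tensor_one_coprod] matches it with the coproduct on the left factor. *)
- rewrite -[d in RHS]scale1r brZ [RHS]tlift_tlift; last exact: balanced_left.
  apply: eq_tlift => g a; rewrite tlift_pure; last exact: balanced_left.
  rewrite (rmorphM (@tensor_one k)) [Delta_id (_ \ox _ * g)]rmorphM /=.
  by rewrite tensor_one_coprod mulrA.
Qed.

Lemma balanced_br_right d : balanced (fun f c =>
  tlift (fun g u => (one_tensor f * id_Delta g) \oxH u) (br d c)).
Proof.
have [brDl brDr brZ] := br_pseudo; split=> [f g c|f a b|f h c].
- rewrite -tlift_add; apply: eq_tlift => F a.
  by rewrite rmorphD mulrDl tpureDl.
- by rewrite brDr tliftD //; exact: balanced_right.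
- rewrite -[d in RHS]scale1r brZ [RHS]tlift_tlift; last exact: balanced_right.
  apply: eq_tlift => g a; rewrite tlift_pure; last exact: balanced_right.
  rewrite (rmorphM (@one_tensor k)) [id_Delta (_ \ox _ * g)]rmorphM /=.
  by rewrite one_tensor_coprod mulrA.
Qed.

Lemma br_left_pure f g c d u : br c d = g \oxH u ->
  br_left br (f \oxH c) d = (tensor_one f * Delta_id g) \oxH u.
Proof.
move=> br_cd; rewrite /br_left tlift_pure; last exact: balanced_br_left.
by rewrite br_cd tlift_pure //; exact: balanced_left.
Qed.

Lemma br_right_pure f g c d u : br d c = g \oxH u ->
  br_right br d (f \oxH c) = (one_tensor f * id_Delta g) \oxH u.
Proof.
move=> br_dc; rewrite /br_right tlift_pure; last exact: balanced_br_right.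
by rewrite br_dc tlift_pure //; exact: balanced_right.
Qed.

End TensorLifts.

(** * Coordinates with respect to a basis *)

Section Coordinates.
Variables (k : fieldType) (L : lmodType {poly k}) (m : nat) (e : m.-tuple L).
Hypothesis e_basis : is_basis e.

Definition coord (x : L) : {ffun 'I_m -> {poly k}} := projT1 (cid (e_basis x)).

Lemma coord_sum x : x = \sum_i coord x i *: tnth e i.
Proof. by rewrite /coord; case: cid => c []. Qed.

Lemma coord_unique x (c : {ffun 'I_m -> {poly k}}) :
  x = \sum_i c i *: tnth e i -> coord x = c.
Proof. by move=> x_c; rewrite /coord; case: cid => c' /= [_ uniq_c]; exact: uniq_c. Qed.

Lemma coordD x y i : coord (x + y) i = coord x i + coord y i.
Proof.
rewrite (@coord_unique _ [ffun i => coord x i + coord y i]) ?ffunE //.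
under eq_bigr do rewrite ffunE scalerDl.
by rewrite big_split /= -!coord_sum.
Qed.

Lemma coordZ h x i : coord (h *: x) i = h * coord x i.
Proof.
rewrite (@coord_unique _ [ffun i => h * coord x i]) ?ffunE //.
under eq_bigr do rewrite ffunE -scalerA.
by rewrite -scaler_sumr -coord_sum.
Qed.

Lemma coord_basis i j : coord (tnth e i) j = (i == j)%:R.
Proof.
rewrite (@coord_unique _ [ffun j => (i == j)%:R]) ?ffunE //.
rewrite (bigD1 i) //= ffunE eqxx scale1r big1 ?addr0 // => l.
by rewrite ffunE eq_sym => /negPf->; rewrite scale0r.
Qed.

(** Moving the [i]-th coordinate into the left factor through the coproduct is balanced; the induced
    map sends [f \oxH tnth e i] back to [f]. *)
Lemma tpure_basis_inj n i : injective (fun f : {mpoly k[n]} => f \oxH tnth e i).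
Proof.
pose phi f a : {mpoly k[n]} := f * coprod n (coord a i).
have phi_balanced : balanced phi.
  split=> [f g a|f a b|f h a]; rewrite /phi ?mulrDl // ?coordD ?coordZ.
    by rewrite rmorphD mulrDr.
  by rewrite rmorphM mulrA.
apply: (can_inj (g := tlift phi)) => f; rewrite tlift_pure //.
by rewrite /phi coord_basis eqxx rmorph1 mulr1.
Qed.

End Coordinates.

(** * Jacobi identities *)

Section Jacobi.
Variables (k : fieldType) (L : lmodType {poly k}) (br : L -> L -> tensorH 2 L).
Hypothesis br_lie : is_lie_pseudoalgebra br.

(** All three terms of the Jacobi identity are pure tensors over the same basis vector, so
    [tpure_basis_inj] reduces it to an identity of polynomials. *)
Lemma lie_jacobi_ev m (e : m.-tuple L) (i : 'I_m) a b d c c' c'' f g f' g' f'' g'' :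
  is_basis e ->
  br a b = f \oxH c -> br c d = g \oxH tnth e i ->
  br b d = f' \oxH c' -> br a c' = g' \oxH tnth e i ->
  br a d = f'' \oxH c'' -> br b c'' = g'' \oxH tnth e i ->
  forall (S : comNzRingType) (phi : {rmorphism k -> S}) x y z,
    ev2 phi x y f * ev2 phi (x + y) z g =
    ev2 phi y z f' * ev2 phi x (y + z) g' - ev2 phi x z f'' * ev2 phi y (x + z) g''.
Proof.
move=> e_basis ab cd bd ac' ad bc'' S phi x y z.
have [br_pseudo jac _] := br_lie.
have := jac a b d; rewrite ab bd ad (br_left_pure br_pseudo _ cd).
rewrite (br_right_pure br_pseudo _ ac') (br_right_pure br_pseudo _ bc'').
rewrite tswap12_pure -tpureNl -tpureDl => /(tpure_basis_inj e_basis)/(congr1 (ev3 phi x y z)).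
rewrite rmorphB !rmorphM /= !ev3_swap12.
by rewrite !(ev3_tensor_one, ev3_one_tensor, ev3_Delta_id, ev3_id_Delta).
Qed.

Lemma lie_skew_pure a b f c : br a b = f \oxH c -> br b a = (- swap12 f) \oxH c.
Proof. by have [_ _ skew] := br_lie; move=> ab; rewrite skew ab tswap12_pure tpureNl. Qed.

End Jacobi.

Lemma ev2_beta_form (k : fieldType) (S : comNzRingType) (phi : {rmorphism k -> S}) x y l c :
  ev2 phi x y (beta_form l c) = phi l * x - y + phi c.
Proof.
rewrite /beta_form !tensor_l tensor_r linearZ /= !horner_algX horner_algC alg_mpolyC.
rewrite !rmorphD rmorphN /= ev2Z ev2C !ev2X rmorphM /= ev2C ev2X !(tnth_nth 0) /=.
by rewrite rmorph1 mulr1.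
Qed.

(* The Jacobi identity of (e_0, a, b) for [e_0, a], [e_0, b], [e_0, c] given by
   beta_form l kap, beta_form l' kap', beta_form m kap'', and [a, b] = f (x)_H c. *)
Definition module_relation (k : fieldType) l l' m kap kap' kap'' (f : {mpoly k[2]}) :=
  forall (S : comNzRingType) (phi : {rmorphism k -> S}) x y z,
  (phi l * x - y + phi kap) * ev2 phi (x + y) z f =
  ev2 phi y z f * (phi m * x - (y + z) + phi kap'') -
  (phi l' * x - z + phi kap') * ev2 phi y (x + z) f.

(** * The identities satisfied by [alpha'] and [eta] *)

Section Relations.
Variables (k : fieldType) (L : lmodType {poly k}) (br : L -> L -> tensorH 2 L).
Variables (D : sv_data L) (l1 l2 k1 k2 : k).
Hypothesis L_sv : schrodinger_virasoro br D.
Hypotheses (beta1E : beta1 D = beta_form l1 k1) (beta2E : beta2 D = beta_form l2 k2).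

Let lie := sv_lie L_sv.

(** In every triple used below the outer brackets are multiples of [e2], the basis vector of index
    2. *)
Let sv_jacobi a b d c c' c'' f g f' g' f'' g''
    (ab : br a b = f \oxH c) (cd : br c d = g \oxH e2 D)
    (bd : br b d = f' \oxH c') (ac' : br a c' = g' \oxH e2 D)
    (ad : br a d = f'' \oxH c'') (bc'' : br b c'' = g'' \oxH e2 D) :=
  lie_jacobi_ev (i := Ordinal (isT : (2 < 4)%N)) lie (sv_basis L_sv) ab cd bd ac' ad bc''.

Lemma alpha'_skew (S : comNzRingType) (phi : {rmorphism k -> S}) y z :
  ev2 phi y z (alpha' D) = - ev2 phi z y (alpha' D).
Proof.
have := lie_skew_pure lie (sv_br11 L_sv); rewrite {1}(sv_br11 L_sv).
move/(tpure_basis_inj (i := Ordinal (isT : (2 < 4)%N)) (sv_basis L_sv)) => {1}->.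
by rewrite rmorphN /= ev2_swap12.
Qed.

Lemma alpha'_module : module_relation l1 l1 l2 k1 k1 k2 (alpha' D).
Proof.
move=> S phi x y z; rewrite -!ev2_beta_form -beta1E -beta2E.
exact: (sv_jacobi (sv_br01 L_sv) (sv_br11 L_sv) (sv_br11 L_sv) (sv_br02 L_sv)
  (sv_br01 L_sv) (sv_br11 L_sv)).
Qed.

Lemma eta_module : module_relation l1 l2 l2 k1 k2 k2 (eta D).
Proof.
move=> S phi x y z; rewrite -!ev2_beta_form -beta1E -beta2E.
exact: (sv_jacobi (sv_br01 L_sv) (sv_br12 L_sv) (sv_br12 L_sv) (sv_br02 L_sv)
  (sv_br02 L_sv) (sv_br12 L_sv)).
Qed.

(** Jacobi identity of [(e1, e1, e2)], whose left-hand side vanishes because $[e_2,e_2]=0$. *)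
Lemma eta_eta (S : comNzRingType) (phi : {rmorphism k -> S}) x y z :
  ev2 phi y z (eta D) * ev2 phi x (y + z) (eta D) =
  ev2 phi x z (eta D) * ev2 phi y (x + z) (eta D).
Proof.
have br22 : br (e2 D) (e2 D) = 0 \oxH e2 D by rewrite tpure0l (sv_br22 L_sv).
have := sv_jacobi (sv_br11 L_sv) br22 (sv_br12 L_sv) (sv_br12 L_sv)
  (sv_br12 L_sv) (sv_br12 L_sv).
by move=> /(_ S phi x y z)/esym/eqP; rewrite rmorph0 mulr0 subr_eq0 => /eqP.
Qed.

(** Jacobi identity of [(e1, e1, e1)]. The sign and the swapped arguments on the left come from
    $[e_2,e_1]$ by skew-symmetry. *)
Lemma alpha'_eta (S : comNzRingType) (phi : {rmorphism k -> S}) x y z :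
  - (ev2 phi x y (alpha' D) * ev2 phi z (x + y) (eta D)) =
  ev2 phi y z (alpha' D) * ev2 phi x (y + z) (eta D) -
  ev2 phi x z (alpha' D) * ev2 phi y (x + z) (eta D).
Proof.
have br21 := lie_skew_pure lie (sv_br12 L_sv).
have := sv_jacobi (sv_br11 L_sv) br21 (sv_br11 L_sv) (sv_br12 L_sv)
  (sv_br11 L_sv) (sv_br12 L_sv).
by move=> /(_ S phi x y z) <-; rewrite rmorphN /= ev2_swap12 mulrN.
Qed.

End Relations.

(** * Taylor coefficients *)

Section BivariateEvaluation.
Variables (R S : comNzRingType) (phi : {rmorphism R -> S}).

Definition bev (u v : S) (G : {poly {poly R}}) : S :=
  (map_poly (map_poly phi) G).[u%:P].[v].

Fact bev_is_zmod u v : zmod_morphism (bev u v).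
Proof. by move=> f g; rewrite /bev rmorphB /= !hornerE. Qed.
Fact bev_is_monoid u v : monoid_morphism (bev u v).
Proof. by split=> [|f g]; rewrite /bev ?rmorph1 ?rmorphM /= ?hornerM // !hornerE. Qed.
HB.instance Definition _ u v := GRing.isZmodMorphism.Build _ _ (bev u v) (bev_is_zmod u v).
HB.instance Definition _ u v := GRing.isMonoidMorphism.Build _ _ (bev u v) (bev_is_monoid u v).

Lemma bevX u v : bev u v 'X = u.
Proof. by rewrite /bev map_polyX !hornerE. Qed.

Lemma bevC u v a : bev u v a%:P = (map_poly phi a).[v].
Proof. by rewrite /bev map_polyC hornerC. Qed.

Lemma bevE u v G : bev u v G = \sum_(i < size G) (map_poly phi G`_i).[v] * u ^+ i.
Proof.
rewrite -{1}[G]coefK poly_def rmorph_sum; apply: eq_bigr => i _ /=.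
by rewrite -mul_polyC rmorphM rmorphXn /= bevX bevC.
Qed.

End BivariateEvaluation.

Section Taylor.
Variables (R : comNzRingType) (a b : R).

(* The powers of 'X_0 - a are the outer ones, those of 'X_1 - b the inner ones. *)
Definition taylor (f : {mpoly R[2]}) : {poly {poly R}} :=
  ev2 (@polyC {poly R} \o @polyC R) ('X + a%:P%:P) ('X%:P + b%:P%:P) f.

Lemma ev2_taylor (S : comNzRingType) (phi : {rmorphism R -> S}) y z f :
  ev2 phi y z f = bev phi (y - phi a) (z - phi b) (taylor f).
Proof.
rewrite -[RHS]/((bev phi (y - phi a) (z - phi b) \o
  ev2 (@polyC {poly R} \o @polyC R) ('X + a%:P%:P) ('X%:P + b%:P%:P)) f).
rewrite [RHS]mpoly_initial; apply: eq_bigr => m _ /=.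
rewrite ev2C /= bevC map_polyC hornerC; congr (_ * _).
apply: eq_bigr => i _; congr (_ ^+ _); rewrite ev2X !(tnth_nth 0).
by case: i => [[|[|i]] lt_i] //=;
  rewrite rmorphD /= ?bevX !bevC !map_polyC ?map_polyX ?hornerX hornerC subrK.
Qed.

End Taylor.

(** Taylor's formula with divided derivatives, which make sense over any ring [B]. *)
Lemma taylor_coef (B : comNzRingType) (p : {poly B}) t m :
  (map_poly polyC p).['X + t%:P]`_m = p^`N(m).[t].
Proof.
rewrite addrC nderiv_taylor; last exact: mulrC.
have -> : \sum_(i < size (map_poly polyC p)) (map_poly polyC p)^`N(i).[t%:P] * 'X^i
  = \poly_(i < size p) p^`N(i).[t].
  rewrite size_map_polyC poly_def; apply: eq_bigr => i _.
  by rewrite nderivn_map horner_map mul_polyC.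
by rewrite coef_poly; case: ltnP => // /nderivn_poly0 ->; rewrite horner0.
Qed.

(* In k[v][u][x] the innermost variable is v, and x is the auxiliary one. *)
Section Tower.
Variable k : comNzRingType.
Let B := {poly {poly k}}.
Let phi : {rmorphism k -> {poly B}} := @polyC B \o (@polyC {poly k} \o @polyC k).
Let u : {poly B} := 'X%:P.
Let v : {poly B} := 'X%:P%:P.

Lemma map_polyCX (A : comNzRingType) (p : {poly A}) : (map_poly polyC p).['X] = p.
Proof. exact: comp_polyXr. Qed.

Lemma map_tower_v a : (map_poly phi a).[v] = a%:P%:P.
Proof.
rewrite /phi (map_poly_comp (@polyC B)) horner_map /=.
by rewrite (map_poly_comp (@polyC {poly k})) horner_map /= map_polyCX.
Qed.

Lemma bev_tower_v w G : bev phi w v G = (map_poly polyC (map_poly polyC G)).[w].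
Proof.
rewrite bevE (@horner_coef_wide _ (size G)) ?size_map_polyC //.
by apply: eq_bigr => i _; rewrite map_tower_v !coef_map.
Qed.

Lemma bev_tower G : bev phi u v G = G%:P.
Proof. by rewrite bev_tower_v horner_map map_polyCX. Qed.

Lemma bev_tower_l G m : (bev phi ('X + u) v G)`_m = G^`N(m).
Proof. by rewrite bev_tower_v taylor_coef nderivn_map map_polyCX. Qed.

Lemma map_tower_r a m : (map_poly phi a).['X + v]`_m = (a^`N(m))%:P.
Proof.
rewrite /phi (map_poly_comp (@polyC B)) taylor_coef.
rewrite (map_poly_comp (@polyC {poly k})) nderivn_map horner_map /=.
by rewrite nderivn_map map_polyCX.
Qed.

(** Shifting the inner variable acts on each coefficient in [u] separately, whence the extra index
    [i]. *)
Lemma bev_tower_r G m i : (bev phi u ('X + v) G)`_m`_i = (G`_i)^`N(m).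
Proof.
rewrite bevE coef_sum.
have -> : \sum_(j < size G) ((map_poly phi G`_j).['X + v] * u ^+ j)`_m
   = \poly_(j < size G) (G`_j)^`N(m).
  rewrite poly_def; apply: eq_bigr => j _.
  by rewrite -rmorphXn /= coefMC map_tower_r mul_polyC.
by rewrite coef_poly; case: ltnP => // le_G; rewrite nth_default // linear0.
Qed.

End Tower.

(** Here [u], [v] are the shifted variables $y-a$, $z-b$, and [P], [Q], [G] are the values of $f$ at
    $(x+y,z)$, $(y,x+z)$, $(y,z)$. The factor [x] isolated on the left shifts degrees by one when
    coefficients are compared. *)
Lemma collect_first_variable (S : comNzRingType) (x u v l l' m a b c P Q G : S) :
  (l * x - (u + a) + a) * P =
    G * (m * x - (u + a + (v + b)) + c) - (l' * x - (v + b) + b) * Q ->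
  x * (l * P - m * G + l' * Q) = u * P + v * Q + (c - a - b - u - v) * G.
Proof.
move=> rel; transitivity ((l * x - (u + a) + a) * P + u * P - m * x * G + l' * x * Q).
  by ring.
by rewrite rel; ring.
Qed.

(** * The recursion for the Taylor coefficients *)

Section ModuleRelation.
Variable k : fieldType.
Implicit Types (f : {mpoly k[2]}).

(** The factorials pass to the divided powers $(s_0-a)^{(i)}(s_1-b)^{(j)}$, for which the binomials
    of the recursion become linear factors. *)
Definition tcoef a b f i j : k := (taylor a b f)`_i`_j * (i`!%:R * j`!%:R).

Lemma module_relation_bev l l' m a b c f (G := taylor a b f) :
  module_relation l l' m a b c f ->
  forall (S : comNzRingType) (phi : {rmorphism k -> S}) x u v
    (P := bev phi (x + u) v G) (Q := bev phi u (x + v) G),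
  x * (phi l * P - phi m * bev phi u v G + phi l' * Q) =
  u * P + v * Q + (phi c - phi a - phi b - u - v) * bev phi u v G.
Proof.
move=> rel S phi x u v P Q; apply: collect_first_variable.
have := rel _ phi x (u + phi a) (v + phi b).
by rewrite !(ev2_taylor a b) !(addrA x) !addrK.
Qed.

(** With formal $x,u,v$, the polynomials $P=G(x+u,v)$ and $Q=G(u,x+v)$ expand in powers of $x$ by
    divided derivatives of $G$, which produce the binomials. *)
Lemma module_relation_tower l l' m a b c f (G := taylor a b f) :
  module_relation l l' m a b c f ->
  exists P Q : {poly {poly {poly k}}},
  [/\ forall n i j, P`_n`_i`_j = G`_(n + i)`_j *+ 'C(n + i, n),
      forall n i j, Q`_n`_i`_j = G`_i`_(n + j) *+ 'C(n + j, n)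
    & 'X * (l%:P%:P%:P * P - m%:P%:P%:P * G%:P + l'%:P%:P%:P * Q) =
      'X%:P * P + 'X%:P%:P * Q
        + ((c%:P%:P - a%:P%:P - b%:P%:P - 'X - 'X%:P) * G)%:P].
Proof.
move=> rel.
pose phi : {rmorphism k -> {poly {poly {poly k}}}} :=
  @polyC {poly {poly k}} \o (@polyC {poly k} \o @polyC k).
exists (bev phi ('X + 'X%:P) 'X%:P%:P G), (bev phi 'X%:P ('X + 'X%:P%:P) G); split.
- by move=> n i j; rewrite bev_tower_l coef_nderivn coefMn.
- by move=> n i j; rewrite bev_tower_r coef_nderivn.
have := module_relation_bev rel phi 'X 'X%:P 'X%:P%:P.
by rewrite -/G bev_tower polyCM !polyCB.
Qed.

Lemma module_relation_coef l l' m a b c f (G := taylor a b f) :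
  module_relation l l' m a b c f ->
  forall n i j,
  l * (G`_(n + i)`_j *+ 'C(n + i, n)) - m * (G`_i`_j *+ (n == 0%N))
    + l' * (G`_i`_(n + j) *+ 'C(n + j, n)) =
  G`_(n + i)`_j *+ 'C(n + i, n.+1) + G`_i`_(n + j) *+ 'C(n + j, n.+1).
Proof.
move=> /module_relation_tower [P [Q [PE QE]]] rel n i j.
(* Compare the coefficients of $x^{n+1}u^iv^j$: the factor $x$ on the left lowers the degree to $n$,
   while [K] is constant in $x$ and drops out. *)
move: (congr1 (fun p : {poly {poly {poly k}}} => p`_n.+1`_i`_j) rel).
move: (_ * taylor a b f) => K; rewrite coefXM !(coefB, coefD, coefCM) [n.+1.-1]/= PE QE.
have -> : K%:P`_n.+1`_i`_j = 0 by rewrite coefC !coef0.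
rewrite addr0 (coefC (taylor a b f)) !coefXM.
(* The factor $u$ lowers [i] by one; at [i = 0] the missing coefficient agrees with
   $\binom{n}{n+1}=0$. *)
have -> : (if i == 0%N then 0 else P`_n.+1`_i.-1)`_j = G`_(n + i)`_j *+ 'C(n + i, n.+1).
  case: i => [|i] /=; last by rewrite PE addSnnS.
  by rewrite coef0 bin_small ?addn0 // mulr0n.
have -> : (if j == 0%N then 0 else Q`_n.+1`_i`_j.-1) = G`_i`_(n + j) *+ 'C(n + j, n.+1).
  case: j => [|j] /=; last by rewrite QE addSnnS.
  by rewrite bin_small ?addn0 // mulr0n.
by rewrite -/G => <-; case: n => [|n] /=; rewrite (coef0, mulr1n) ?coef0.
Qed.

(** At $x=0$ both [P] and [Q] become [G], so the terms in $u$ and $v$ cancel and $(c-a-b)G=0$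
    remains in a domain. *)
Lemma module_relation_kappa l l' m a b c f :
  module_relation l l' m a b c f -> taylor a b f != 0 -> c = a + b.
Proof.
set G := taylor a b f => /module_relation_tower [P [Q [PE QE]]]; rewrite -/G => rel G_neq0.
have P0 : P`_0 = G by apply/polyP => i; apply/polyP => j; rewrite PE bin0.
have Q0 : Q`_0 = G by apply/polyP => i; apply/polyP => j; rewrite QE bin0.
move: (congr1 (fun p : {poly {poly {poly k}}} => p`_0) rel).
rewrite coefXM !(coefD, coefCM) coefC P0 Q0.
move=> /esym rel0; have {rel0} : (c%:P%:P - a%:P%:P - b%:P%:P) * G = 0.
  by rewrite -rel0 /=; ring.
move/eqP; rewrite mulf_eq0 (negPf G_neq0) orbF -!rmorphB /= !polyC_eq0.
by rewrite -addrA -opprD subr_eq0 => /eqP.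
Qed.

Lemma binD_factR n i : 'C(n + i, n)%:R * (n.+1`!%:R * i`!%:R) = n.+1%:R * (n + i)`!%:R :> k.
Proof.
rewrite -!natrM; congr _%:R.
by rewrite factS -mulnA mulnCA -(bin_fact (leq_addr i n)) addKn.
Qed.

Lemma binDS_factR n i : 'C(n + i, n.+1)%:R * (n.+1`!%:R * i`!%:R) = i%:R * (n + i)`!%:R :> k.
Proof.
rewrite -!natrM; congr _%:R; case: i => [|i]; first by rewrite addn0 bin_small.
rewrite (factS i) (mulnCA n.+1`!) mulnCA -addSnnS.
by rewrite -(bin_fact (leq_addr i n.+1)) addKn.
Qed.

(** The coefficient relation is multiplied by [e * fi * fj], that is by $(n+1)!\,i!\,j!$ in the
    application, where the variable [n] stands for $n+1$. There [s] is the indicator of $n=0$, a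
    case in which [e] is 1, hence [s * e = s]. *)
Lemma clear_factorials (S : comNzRingType)
    (l l' m n i j e fi fj fni fnj ci ci' cj cj' g0 g1 g2 s : S) :
  ci * (e * fi) = n * fni -> ci' * (e * fi) = i * fni ->
  cj * (e * fj) = n * fnj -> cj' * (e * fj) = j * fnj -> s * e = s ->
  l * (g1 * ci) - m * (g0 * s) + l' * (g2 * cj) = g1 * ci' + g2 * cj' ->
  (n * l - i) * (g1 * (fni * fj)) + (n * l' - j) * (g2 * (fi * fnj)) =
  m * (g0 * (fi * fj) * s).
Proof.
move=> ciE ci'E cjE cj'E se rel.
transitivity (g1 * fj * l * (n * fni) - g1 * fj * (i * fni)
  + g2 * fi * l' * (n * fnj) - g2 * fi * (j * fnj)); first by ring.
rewrite -ciE -ci'E -cjE -cj'E -se.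
transitivity ((l * (g1 * ci) - m * (g0 * s) + l' * (g2 * cj) - (g1 * ci' + g2 * cj'))
  * (e * fi * fj) + m * g0 * (s * e) * fi * fj); first by ring.
by rewrite rel; ring.
Qed.

Lemma module_relation_tcoef l l' m a b c f (d := tcoef a b f) :
  module_relation l l' m a b c f ->
  forall n i j,
  (n.+1%:R * l - i%:R) * d (n + i)%N j + (n.+1%:R * l' - j%:R) * d i (n + j)%N =
  m * (d i j * (n == 0%N)%:R).
Proof.
move=> /module_relation_coef rel n i j; rewrite /d /tcoef.
apply: clear_factorials (binD_factR n i) (binDS_factR n i)
  (binD_factR n j) (binDS_factR n j) _ _.
  by case: n => [|n]; rewrite ?mul0r ?mulr1.
by rewrite !mulr_natr rel.
Qed.

End ModuleRelation.

(** * Solutions of the recursion *)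

Section CoefficientRecursion.
Variable k : fieldType.
Hypothesis k_char0 : [pchar k] =i pred0.

Lemma natr_eq0 n : (n%:R == 0 :> k) = (n == 0%N).
Proof. by move/pcharf0P: k_char0 => ->. Qed.

Lemma field_natr_eq0 (K : fieldType) (phi : {rmorphism k -> K}) n :
  (n%:R == 0 :> K) = (n == 0%N).
Proof. by rewrite -(rmorph_nat phi) fmorph_eq0 natr_eq0. Qed.

Lemma natr_inj : injective (fun n : nat => n%:R : k).
Proof.
move=> m n; wlog le_mn : m n / (m <= n)%N => [hw|] mn.
  by case/orP: (leq_total m n) => /hw; [|move/(_ (esym mn))/esym]; auto.
apply/eqP; rewrite eqn_leq le_mn -subn_eq0 -natr_eq0 natrB //.
by rewrite [X in _ - X]mn subrr eqxx.
Qed.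

Definition coef_relation (l l' m : k) (d : nat -> nat -> k) :=
  forall n i j,
  (n.+1%:R * l - i%:R) * d (n + i)%N j + (n.+1%:R * l' - j%:R) * d i (n + j)%N =
  m * (d i j * (n == 0%N)%:R).

Lemma coef_relation_degree l l' m d i j :
  coef_relation l l' m d -> d i j != 0 -> l + l' - m = (i + j)%:R.
Proof.
move=> /(_ 0%N i j); rewrite !add0n mulr1 => rel dij.
by apply: (mulIf dij); rewrite !mulrBl mulrDl -rel natrD; ring.
Qed.

Lemma coef_relation_homogeneous l l' m d N :
  coef_relation l l' m d -> l + l' - m = N%:R ->
  forall i j, (i + j)%N <> N -> d i j = 0.
Proof.
move=> rel deg i j; apply: contra_notP => /eqP/(coef_relation_degree rel).
by rewrite deg => /natr_inj.
Qed.

Section SkewSolutions.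
Variables (l m : k) (d : nat -> nat -> k).
Hypotheses (rel : coef_relation l l m d) (skew : forall i j, d i j = - d j i).

Lemma skew_diag i : d i i = 0.
Proof.
have : d i i *+ 2 = 0 by rewrite mulr2n {1}skew addNr.
by move/eqP; rewrite -mulr_natr mulf_eq0 natr_eq0 orbF => /eqP.
Qed.

Let relS n i j : (n.+2%:R * l - i%:R) * d (n.+1 + i) j +
  (n.+2%:R * l - j%:R) * d i (n.+1 + j) = 0.
Proof. by rewrite rel !mulr0. Qed.

Let rel0 n j : n.+2%:R * l * d n.+1 j = - ((n.+2%:R * l - j%:R) * d 0 (n.+1 + j)).
Proof. by apply/eqP; rewrite -addr_eq0 -(relS n 0 j) subr0 addn0. Qed.

Lemma skew_solution_lambda_neq0 i0 j0 : l != 0 -> d i0 j0 != 0 ->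
  [\/ (i0 + j0)%N = 1%N,
      (i0 + j0)%N = 2%N /\ l = 1 / 2
    | (i0 + j0)%N = 3%N /\ l = 2 / 3 /\ d 1 2 = d 0 3 / 2].
Proof.
move=> l_neq0 dij.
(* As [l] is nonzero, [rel0] makes every coefficient of degree $N$ a multiple of $d_{0N}$. *)
have c_neq0 : d 0 (i0 + j0) != 0.
  apply: contraNneq dij => c0; case: i0 c0 => [|i] c0; first by rewrite c0.
  have /eqP := rel0 i j0; rewrite c0 mulr0 oppr0 mulf_eq0.
  by rewrite mulf_eq0 (negPf l_neq0) natr_eq0.
case N_def: (i0 + j0)%N c_neq0 => [|[|[|[|M]]]] c_neq0.
- by rewrite skew_diag eqxx in c_neq0.
- by constructor 1.
(* Here $d_{11}=0$, so the recursion reads $(2l-1)d_{02}=0$. *)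
- constructor 2; split=> //; have := rel0 0 1; rewrite skew_diag mulr0.
  move/esym/eqP; rewrite oppr_eq0 mulf_eq0 (negPf c_neq0) orbF subr_eq0 => /eqP l2.
  have two_neq0 : (2 : k) != 0 by rewrite natr_eq0.
  by apply: (mulfI two_neq0); rewrite l2; field.
- have E1 := rel0 0 2; have E2 := rel0 1 1; rewrite (skew 2 1) in E2.
  rewrite (_ : 1 + 2 = 3)%N // in E1; rewrite (_ : 2 + 1 = 3)%N // in E2.
  (* Since $d_{21}=-d_{12}$, three times [E1] plus twice [E2] eliminates $d_{12}$ and leaves
     $(12l-8)d_{03}=0$. *)
  have l3 : l = 2 / 3.
    have twelve_neq0 : (12 : k) != 0 by rewrite natr_eq0.
    apply: (mulIf c_neq0); apply: (mulfI twelve_neq0); apply/eqP; rewrite -subr_eq0.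
    rewrite (_ : _ - _ = 3 * (2 * l * d 1 2 - - ((2 * l - 2) * d 0 3))
      + 2 * (3 * l * - d 1 2 - - ((3 * l - 1) * d 0 3))); last by field; rewrite natr_eq0.
    by rewrite E1 E2 !subrr !mulr0 addr0.
  constructor 3; do 2?split=> //.
  rewrite (_ : d 1 2 = 3 / 4 * (2 * l * d 1 2)); last by rewrite l3; field; rewrite !natr_eq0.
  by rewrite E1 l3; field; rewrite !natr_eq0.
- have E1 := rel0 0 M.+3; have E1' := rel0 M.+2 1.
  have E2 := rel0 1 M.+2; have E2' := rel0 M.+1 2.
  rewrite (skew _ 1) in E1'; rewrite (skew _ 2) in E2'.
  rewrite !add1n addn1 add2n addn2 in E1 E1' E2 E2'.
  (* Eliminating d 1 _, d 2 _ and l leaves (N - 3) (N + 1) (N + 2) = 0, N = M + 4. *)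
  have : (M.+1 * M.+4.+1 * M.+4.+2)%:R * d 0 M.+4 = 0.
    transitivity (2 * M.+4%:R * (M.+3%:R * (3 * l * d 2 M.+2 - - ((3 * l - M.+2%:R) * d 0 M.+4))
        + 3 * (M.+3%:R * l * - d 2 M.+2 - - ((M.+3%:R * l - 2) * d 0 M.+4)))
      - 3 * M.+3%:R * (M.+4%:R * (2 * l * d 1 M.+3 - - ((2 * l - M.+3%:R) * d 0 M.+4))
        + 2 * (M.+4%:R * l * - d 1 M.+3 - - ((M.+4%:R * l - 1) * d 0 M.+4)))).
      ring.
    by rewrite E1 E1' E2 E2' !subrr !mulr0 !addr0 !mulr0 subrr.
  by move/eqP; rewrite mulf_eq0 (negPf c_neq0) orbF natr_eq0 !muln_eq0.
Qed.

Lemma skew_solution_lambda0 i0 j0 : l = 0 -> d i0 j0 != 0 ->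
  (i0 + j0)%N = 1%N \/ (i0 + j0)%N = 3%N /\ d 0 3 = 0.
Proof.
move=> l0 dij.
have relS' n i j : i%:R * d (n.+1 + i)%N j = - (j%:R * d i (n.+1 + j)%N).
  by apply/eqP; rewrite -addr_eq0 -oppr_eq0 -[0 as X in _ == X](relS n i j) l0; apply/eqP; ring.
(* The row [i = 0] of [relS'] has a zero left-hand side. *)
have c0 n : d 0 n.+2 = 0.
  have /esym/eqP := relS' 0%N 0%N n.+1.
  by rewrite mul0r oppr_eq0 mulf_eq0 natr_eq0 => /eqP.
case N_def: (i0 + j0)%N => [|[|[|[|M]]]].
- by case: i0 j0 N_def dij => [|?] [|?] // _; rewrite skew_diag eqxx.
- by left.
- case/negP: dij; case: i0 j0 N_def => [|[|[|i]]] [|[|[|j]]] //= _; rewrite ?c0 ?skew_diag //.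
  by rewrite skew c0 oppr0.
- by right.
(* Two expressions of $d_{2,N-2}$ through $d_{1,N-1}$, one of them by skew-symmetry, combine to
   $N\,d_{1,N-1}=0$ with $N=M+4$. The remaining coefficients are multiples of $d_{1,N-1}$. *)
- case/negP: dij; have e0 : d 1 M.+3 = 0.
    have := relS' M 1%N 2; have := relS' 0%N 1%N M.+2.
    rewrite !mul1r !addn1 addn2 !add1n (skew M.+2) => -> E.
    have : M.+4%:R * d 1 M.+3 = 0.
      transitivity (- - (M.+2%:R * d 1 M.+3) - - (2 * d 1 M.+3)); first by ring.
      by rewrite E subrr.
    by move/eqP; rewrite mulf_eq0 natr_eq0 => /eqP.
  apply/eqP; case: i0 N_def => [|[|i]] N_def.
  + by rewrite -[j0]/(0 + j0)%N N_def c0.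
  + by have -> : j0 = M.+3 by [case: N_def].
  have := relS' i 1%N j0; rewrite mul1r addn1 => ->.
  by have -> : (i.+1 + j0)%N = M.+3 by [case: N_def => <-]; rewrite e0 mulr0 oppr0.
Qed.
End SkewSolutions.

(** The degree relation gives $l=i+j$. If $i>0$, the recursion with vanishing row 0 also gives
    $l\,d_{ij}=0$, a contradiction. *)
Lemma const_solution l m d i j :
  coef_relation l m m d -> (forall n, d 0 n.+1 = 0) -> d i j != 0 ->
  [/\ l = 0, i = 0%N & j = 0%N].
Proof.
move=> rel d0 dij; have := coef_relation_degree rel dij; rewrite addrK => l_deg.
case: i dij l_deg => [|i] dij l_deg.
  by case: j dij l_deg => [|j]; rewrite ?d0 ?eqxx.
have /eqP := rel i.+1 0%N j; rewrite !d0 !mulr0 subr0 addr0 addn0.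
rewrite mulf_eq0 (negPf dij) orbF l_deg mulf_eq0 !natr_eq0. by [].
Qed.

End CoefficientRecursion.

(** The polynomial ring embeds in its fraction field, so testing at field-valued points suffices;
    there denominators can be cleared. *)
Lemma ev2_inj_field (k : fieldType) (f g : {mpoly k[2]}) :
  (forall (K : fieldType) (phi : {rmorphism k -> K}) y z, ev2 phi y z f = ev2 phi y z g) ->
  f = g.
Proof.
move=> eq_fg; apply/eqP; rewrite -tofrac_eq; apply/eqP.
pose phi : {rmorphism k -> {fraction {mpoly k[2]}}} := @tofrac {mpoly k[2]} \o @mpolyC 2 k.
have tofracE h : tofrac h = ev2 phi (tofrac 'X_0) (tofrac 'X_1) h.
  rewrite mpoly_initial; apply: eq_bigr => m _; congr (_ * _).
  apply: eq_bigr => i _; congr (_ ^+ _); rewrite !(tnth_nth 0).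
  by case: i => [[|[|i]] lt_i] //=; congr tofrac; congr 'X_ _; apply: val_inj.
by rewrite (tofracE f) (tofracE g); exact: eq_fg.
Qed.

(** * Recovering a polynomial from its Taylor coefficients *)

Section TaylorCoefficients.
Variable k : fieldType.
Hypothesis k_char0 : [pchar k] =i pred0.
Variables (a b : k) (f : {mpoly k[2]}).

Lemma taylor_tcoef i j : (taylor a b f)`_i`_j = tcoef a b f i j / (i`!%:R * j`!%:R).
Proof. by rewrite mulfK // mulf_neq0 // natr_eq0 // -lt0n fact_gt0. Qed.

Lemma taylor_neq0 : f != 0 -> taylor a b f != 0.
Proof.
apply: contra_neq => f0; apply: ev2_inj_field => K phi y z.
by rewrite (ev2_taylor a b) f0 !rmorph0.
Qed.

Lemma tcoef_neq0 : f != 0 -> exists i j, tcoef a b f i j != 0.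
Proof.
move/taylor_neq0; apply: contra_neqP => none.
apply/polyP => i; apply/polyP => j; rewrite taylor_tcoef !coef0.
have [->|nz] := eqVneq (tcoef a b f i j) 0; first by rewrite mul0r.
by case: none; exists i, j.
Qed.

Lemma ev2_homogeneous N :
  (forall i j, (i + j)%N <> N -> tcoef a b f i j = 0) ->
  forall (K : fieldType) (phi : {rmorphism k -> K}) y z,
  ev2 phi y z f = \sum_(i < N.+1)
    phi (tcoef a b f i (N - i)) / (i`!%:R * (N - i)`!%:R) *
    ((y - phi a) ^+ i * (z - phi b) ^+ (N - i)).
Proof.
move=> hom K phi y z; rewrite (ev2_taylor a b).
have -> : taylor a b f =
    \sum_(i < N.+1) ((taylor a b f)`_i`_(N - i) *: 'X^(N - i))%:P * 'X^i.
  apply/polyP => i; apply/polyP => j.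
  under eq_bigr do rewrite mul_polyC.
  rewrite -(poly_def N.+1 (fun i => (taylor a b f)`_i`_(N - i) *: 'X^(N - i))).
  rewrite coef_poly ltnS; case: leqP => [le_iN|lt_Ni]; last first.
    rewrite coef0 taylor_tcoef hom ?mul0r // => ijN.
    by move: lt_Ni; rewrite -ijN ltnNge leq_addr.
  rewrite coefZ coefXn; case: eqP => [->|neq_j]; first by rewrite mulr1.
  rewrite mulr0 taylor_tcoef hom ?mul0r // => ijN.
  by case: neq_j; rewrite -ijN addKn.
rewrite rmorph_sum; apply: eq_bigr => i _.
rewrite rmorphM rmorphXn /= bevX bevC -mul_polyC rmorphM /= map_polyC map_polyXn.
have phiE : phi (taylor a b f)`_i`_(N - i) =
    phi (tcoef a b f i (N - i)) / (i`!%:R * (N - i)`!%:R).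
  by rewrite taylor_tcoef fmorph_div -!natrM rmorph_nat.
by rewrite hornerM hornerC hornerXn -phiE -mulrA (mulrC (_ ^+ (N - i))).
Qed.

(** Exchanging the variables transposes the array of Taylor coefficients, because both are shifted
    by the same scalar. *)
Lemma tcoef_skew : a = b ->
  (forall (S : comNzRingType) (phi : {rmorphism k -> S}) y z,
    ev2 phi y z f = - ev2 phi z y f) ->
  forall i j, tcoef a b f i j = - tcoef a b f j i.
Proof.
move=> ab skew i j; rewrite /tcoef -mulNr [X in _ = _ * X]mulrC; congr (_ * _).
pose phi : {rmorphism k -> {poly {poly k}}} := @polyC {poly k} \o @polyC k.
rewrite {1}/taylor skew -[ev2 _ _ _ f]/(ev2 phi _ _ f) (ev2_taylor a b) !coefN; congr (- _).
rewrite -ab -[a%:P%:P]/(phi a) !addrK.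
have map_phiX p : (map_poly phi p).['X] = map_poly polyC p.
  by rewrite /phi map_poly_comp map_polyCX.
rewrite bevE; under eq_bigr do rewrite map_phiX mulrC -rmorphXn mul_polyC /=.
rewrite coef_sum; under eq_bigr do rewrite coefZ coef_map mulrC mul_polyC.
rewrite -(poly_def _ (fun p => (taylor a a f)`_p`_i)) coef_poly.
by case: ltnP => // le_G; rewrite (nth_default 0 le_G) coef0.
Qed.

End TaylorCoefficients.

Lemma ev2_wedge (k K : fieldType) (phi : {rmorphism k -> K}) y z i j :
  ev2 phi y z (wedge k i j) =
  (y ^+ i * z ^+ j - y ^+ j * z ^+ i) / (i`!%:R * j`!%:R).
Proof.
have divpowE n m : ev2 phi y z (divpow k n \ox divpow k m) =
    y ^+ n * z ^+ m / (n`!%:R * m`!%:R).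
  rewrite /tensor2 /divpow -!mul_polyC !rmorphM !rmorphXn /= !horner_algC !horner_algX.
  rewrite !alg_mpolyC !ev2C !ev2X !(tnth_nth 0) /=.
  rewrite !fmorphV !rmorph_nat invfM.
  by ring.
by rewrite /wedge rmorphB /= !divpowE [j`!%:R * _]mulrC -mulrBl.
Qed.

Lemma ev2_tensor_lC (k : fieldType) (S : comNzRingType) (phi : {rmorphism k -> S}) y z c :
  ev2 phi y z (c%:P \ox 1) = phi c.
Proof. by rewrite tensor_l horner_algC alg_mpolyC ev2C. Qed.

(** * Determination of [eta] *)

Section Eta.
Variables (k : fieldType) (E : {mpoly k[2]}) (l1 l2 k1 k2 : k).
Hypothesis k_char0 : [pchar k] =i pred0.
Hypothesis E_module : module_relation l1 l2 l2 k1 k2 k2 E.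
Hypothesis E_E : forall (S : comNzRingType) (phi : {rmorphism k -> S}) x y z,
  ev2 phi y z E * ev2 phi x (y + z) E = ev2 phi x z E * ev2 phi y (x + z) E.

Lemma eta_tcoef0 n : E != 0 -> k1 = 0 -> tcoef k1 k2 E 0 n.+1 = 0.
Proof.
move=> E_neq0 k1_0; have G_neq0 := taylor_neq0 k1 k2 E_neq0.
pose phi : {rmorphism k -> {poly {poly k}}} := @polyC {poly k} \o @polyC k.
(* At $y=0$ both sides contain $E(x,z)$, which is the nonzero Taylor polynomial; cancelling it
   leaves $E(0,z)=E(0,x+z)$. *)
have := E_E phi 'X 0 ('X%:P + phi k2).
have GE : ev2 phi 'X ('X%:P + phi k2) E = taylor k1 k2 E.
  by rewrite /taylor k1_0 !rmorph0 addr0.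
rewrite add0r GE mulrC => /(mulfI G_neq0).
rewrite !(ev2_taylor k1 k2) k1_0 rmorph0 subrr addrA !addrK.
rewrite /bev rmorph0 !horner_coef0 coef_map.
rewrite /phi /= !map_poly_comp.
(* The coefficient of $x^{n+1}$ at $v=0$ vanishes on the side free of $x$; on the other it is the
   Taylor coefficient of index $(0,n+1)$. *)
move/(congr1 (fun p : {poly {poly k}} => p`_n.+1`_0)).
rewrite taylor_coef horner_map /= nderivn_map !map_polyCX coefC coef0.
rewrite coef_nderivn addn0 binn mulr1n.
by rewrite /tcoef => <-; rewrite mul0r.
Qed.

Lemma eta_const : exists a, [/\ E = a%:P \ox 1, a * l1 = 0 & a * k1 = 0].
Proof.
have [->|E_neq0] := eqVneq E 0.
  by exists 0; rewrite !mul0r tensor_l !rmorph0.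
(* For [eta] the relation between the constants reads [k2 = k1 + k2]. *)
have k1_0 : k1 = 0.
  by have := module_relation_kappa E_module (taylor_neq0 k1 k2 E_neq0);
    rewrite -{1}[k2]add0r => /addIr.
have d0 n : tcoef k1 k2 E 0 n.+1 = 0 by exact: eta_tcoef0.
have const := const_solution k_char0 (module_relation_tcoef E_module) d0.
have [i [j dij]] := tcoef_neq0 k_char0 k1 k2 E_neq0.
have [l1_0 _ _] := const _ _ dij.
exists (tcoef k1 k2 E 0 0); rewrite l1_0 k1_0 !mulr0; split=> //.
apply: ev2_inj_field => K phi y z; rewrite ev2_tensor_lC.
rewrite (ev2_homogeneous k_char0 (N := 0) (a := k1) (b := k2)) => [|r s rs].
  by rewrite big_ord1 mulr1 divr1 mulr1 k1_0.
by apply/eqP; apply: contra_notT rs => /const [_ -> ->].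
Qed.
End Eta.

(** * Determination of [alpha'] *)

Section Alpha.
Variables (k : fieldType) (A : {mpoly k[2]}) (l1 l2 k1 k2 : k).
Hypothesis k_char0 : [pchar k] =i pred0.
Hypothesis A_module : module_relation l1 l1 l2 k1 k1 k2 A.
Hypothesis A_skew : forall (S : comNzRingType) (phi : {rmorphism k -> S}) y z,
  ev2 phi y z A = - ev2 phi z y A.

(** The degree is 1, 2 or 3, and skew-symmetry leaves one free coefficient [w]. The lower wedges
    with powers of [k1] arise from expanding the divided powers of $s-\kappa_1$. *)
Lemma alpha'_solutions : A != 0 ->
  k2 = 2 * k1 /\
  [\/ l2 = 2 * l1 - 1 /\ exists w, A = w *: wedge k 0 1,
      [/\ l1 = 0, l2 = - 3 & exists w, A = - (w *: (k1 *: wedge k 0 2 - wedge k 1 2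
                          - (k1 ^+ 2 / 2) *: wedge k 0 1))],
      [/\ l1 = 1 / 2, l2 = - 1 & exists w, A = w *: (wedge k 0 2 - k1 *: wedge k 0 1)]
    | [/\ l1 = 2 / 3, l2 = - (5 / 3) & exists w,
          A = w *: (wedge k 0 3 + (1 / 2) *: wedge k 1 2
                       - (3 * k1 / 2) *: wedge k 0 2
                       + (3 / 4 * k1 ^+ 2) *: wedge k 0 1)]].
Proof.
move=> A_neq0; split.
  by rewrite (module_relation_kappa A_module (taylor_neq0 k1 k1 A_neq0)) mulr_natl mulr2n.
have rel := module_relation_tcoef A_module; rewrite -/(coef_relation _ _ _ _) in rel.
have skew := tcoef_skew (erefl k1) A_skew.
have [i [j dij]] := tcoef_neq0 k_char0 k1 k1 A_neq0.
have deg := coef_relation_degree rel dij.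
have l2E : l2 = 2 * l1 - (i + j)%:R by rewrite -deg; ring.
have := ev2_homogeneous k_char0 (coef_relation_homogeneous k_char0 rel deg).
have diag := skew_diag k_char0 skew.
have two_neq0 : (2 : k) != 0 by rewrite natr_eq0.
have three_neq0 : (3 : k) != 0 by rewrite natr_eq0.
have facts : (0`! = 1) * (1`! = 1) * (2`! = 2) * (3`! = 6) by [].
have sum_wedge := (ev2_wedge, ev2Z, ev2B, ev2D, big_ord_recl, big_ord0).
have [l1_0|l1_neq0] := eqVneq l1 0.
  case: (skew_solution_lambda0 k_char0 rel skew l1_0 dij) => [N1|[N3 d03]].
    rewrite l2E N1 => AE; constructor 1; split=> //.
    exists (tcoef k1 k1 A 0 1); apply: ev2_inj_field => K phi y z.
    rewrite AE !sum_wedge /= /bump /= (skew 1 0) rmorphN !facts.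
    by move: (tcoef _ _ _ _ _) => d; field; rewrite oner_eq0.
  rewrite l2E N3 l1_0 => AE; constructor 2; split=> //; first by ring.
  (* As $d_{03}=0$, only $d_{12}=-d_{21}$ survives. *)
  exists (tcoef k1 k1 A 1 2); apply: ev2_inj_field => K phi y z.
  rewrite AE rmorphN /= !sum_wedge /= /bump /= (skew 3 0) (skew 2 1) d03 !facts.
  move: (tcoef _ _ _ _ _) => d.
  have char0K := field_natr_eq0 k_char0 phi.
  by field; rewrite ?oner_eq0 ?char0K.
have := skew_solution_lambda_neq0 k_char0 rel skew l1_neq0 dij.
case=> [N1|[N2 l1E]|[N3 [l1E d12]]].
- rewrite l2E N1 => AE; constructor 1; split=> //.
  exists (tcoef k1 k1 A 0 1); apply: ev2_inj_field => K phi y z.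
  rewrite AE !sum_wedge /= /bump /= (skew 1 0) rmorphN !facts.
  by move: (tcoef _ _ _ _ _) => d; field; rewrite oner_eq0.
- rewrite l2E N2 l1E => AE; constructor 3; split=> //; first by field.
  exists (tcoef k1 k1 A 0 2); apply: ev2_inj_field => K phi y z.
  rewrite AE !sum_wedge /= /bump /= (skew 2 0) diag rmorphN rmorph0 !facts.
  move: (tcoef _ _ _ _ _) => d.
  have char0K := field_natr_eq0 k_char0 phi.
  by field; rewrite ?oner_eq0 ?char0K.
- rewrite l2E N3 l1E => AE; constructor 4; split=> //; first by field.
  exists (tcoef k1 k1 A 0 3); apply: ev2_inj_field => K phi y z.
  rewrite AE !sum_wedge /= /bump /= (skew 3 0) (skew 2 1) d12 !facts.
  move: (tcoef _ _ _ _ _) => d.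
  have char0K := field_natr_eq0 k_char0 phi.
  by field; rewrite ?oner_eq0 ?char0K.
Qed.
End Alpha.

Theorem proposition5p1 (k : fieldType) (k_char0 : [pchar k] =i pred0)
  (L : lmodType {poly k}) (br : L -> L -> tensorH 2 L) (D : sv_data L)
  (L_sv : schrodinger_virasoro br D)
  (eta11_0 : eta11 D = 0) (eta12_0 : eta12 D = 0)
  (eta21_0 : eta21 D = 0) (eta22_0 : eta22 D = 0) :
  Z1 D \/ Z2 D \/ Z3 D \/ Z4 D \/ Z5 D.
Proof.
have [l1 [k1 beta1E]] := sv_beta1 L_sv.
have [l2 [k2 beta2E]] := sv_beta2 L_sv.
have [l3 [k3 beta3E]] := sv_beta3 L_sv.
have [a [etaE al1 ak1]] :=
  eta_const k_char0 (eta_module L_sv beta1E beta2E) (eta_eta L_sv).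
have [A0|A_neq0] := eqVneq (alpha' D) 0.
  by left; exists a, l1, l2, l3, k1, k2, k3.
have skew := alpha'_skew L_sv.
have eta0 : a = 0 -> eta D = 0.
  by move=> a0; rewrite etaE a0 tensor_l !rmorph0.
have [k2E] := alpha'_solutions k_char0 (alpha'_module L_sv beta1E beta2E) skew A_neq0.
rewrite k2E in beta2E.
case=> [[l2E [w AE]]|[l1E l2E [w AE]]|[l1E l2E [w AE]]|[l1E l2E [w AE]]];
  rewrite l2E in beta2E.
- by right; left; exists w, a, l1, l3, k1, k3.
- rewrite l1E in beta1E.
  right; right; left; exists w, l3, k1, k3; do !split=> //; apply: eta0.
  (* If [a] were nonzero, then $\kappa_1=0$ and [alpha'] would be a multiple of [wedge 1 2], which
     vanishes when its second argument is 0. Setting $z=0$ in [alpha'_eta] then gives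
     $a\,\alpha'=0$. *)
  apply/eqP; apply: contraNT A_neq0 => a_neq0; apply/eqP.
  have k1_0 : k1 = 0 by move/eqP: ak1; rewrite mulf_eq0 (negPf a_neq0) => /eqP.
  apply: ev2_inj_field => K phi y z; rewrite rmorph0.
  have A_0 x : ev2 phi x 0 (alpha' D) = 0.
    rewrite AE k1_0 rmorphN /= !(ev2_wedge, ev2Z, ev2B) !expr0n /=.
    by rewrite !(rmorph0, mul0r, mulr0, subr0, oppr0).
  have a_neq0' : phi a != 0 by rewrite fmorph_eq0.
  have := alpha'_eta L_sv phi y z 0; rewrite etaE !ev2_tensor_lC !A_0 !mul0r subrr.
  by move/eqP; rewrite oppr_eq0 mulf_eq0 (negPf a_neq0') orbF => /eqP.
- rewrite l1E in beta1E al1.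
  right; right; right; left; exists w, l3, k1, k3; do !split=> //; apply: eta0.
  (* Now $\lambda_1=\frac12$ is nonzero, so $a\lambda_1=0$ forces $a=0$. *)
  by apply/eqP; move/eqP: al1; rewrite !mulf_eq0 invr_eq0 ?oner_eq0 !natr_eq0 // !orbF.
- rewrite l1E in beta1E al1.
  right; right; right; right; exists w, l3, k1, k3; do !split=> //; apply: eta0.
  by apply/eqP; move/eqP: al1; rewrite !mulf_eq0 invr_eq0 ?oner_eq0 !natr_eq0 // !orbF.
Qed.
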